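(* Let $n\ge 4$ with $n\equiv0\pmod 4$. In frequency ordering, the cycle graph $C_n$ has exactly four minimal positively weighted extremal designs, each consisting of $n/2$ vertices. They are the sets $$\{\,i,\,i+1 : i\in[n],\ i\equiv j \pmod 4\,\},\qquad j\in\{1,2,3,4\},$$ where $i+1$ is read modulo $n$.
   Context: $C_n$ is the cycle with vertex set $[n]=\{1,\dots,n\}$ (read as $\mathbb{Z}/n$), where $i$ is adjacent to $i\pm1$ modulo $n$. For a connected $\delta$-regular graph $G$ on $n$ vertices with adjacency matrix $A$, eigenvalues and eigenspaces mean those of $\frac1\delta A$. Frequency order means that eigenspaces $\Lambda_1<\cdots<\Lambda_m$ are ordered by decreasing absolute value of the eigenvalue, with $\Lambda_1=\operatorname{span}\{\mathbb{1}\}$ (eigenvalue $1$) first. A vertex subset $W$ with weights $(a_w)_{w\in W}$ averages an eigenspace $\Lambda$ if $\sum_{w\in W}a_w\phi(w)=\frac1n\sum_{v}\phi(v)$ for all $\phi\in\Lambda$. $W$ is a positively weighted extremal design if there are weights $a_w>0$ with which $W$ averages all eigenspaces except the last one. Minimal means inclusion-minimal among positively weighted extremal designs. *)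

(* Defs.v *)
From HB Require Import structures.
From mathcomp Require Import all_boot all_order all_algebra.
From mathcomp Require Import boolp reals.

Set Implicit Arguments.
Unset Strict Implicit.
Unset Printing Implicit Defensive.

Import Order.TTheory GRing.Theory Num.Theory.

Local Open Scope ring_scope.

(* Graphs on n vertices are adjacency relations on 'I_n. *)

Definition adjacency_mx (R : realType) (n : nat) (e : rel 'I_n) : 'M[R]_n :=
  \matrix_(i, j) (e i j)%:R.

Definition norm_adjacency_mx (R : realType) (n : nat) (delta : nat)
    (e : rel 'I_n) : 'M[R]_n :=
  delta%:R^-1 *: adjacency_mx R e.

(* An ordering of the eigenspaces is given by the list of the corresponding
   distinct eigenvalues.  Eigenvalues of equal absolute value, such as l and
   - l, may come in either order, except that 1 is first. *)
Definition frequency_order (R : realType) (n : nat) (M : 'M[R]_n)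
    (s : seq R) : Prop :=
  [/\ uniq s,
      forall x : R, (x \in s) = eigenvalue M x,
      ohead s = Some 1
    & sorted (fun x y : R => `|y| <= `|x|) s].

(* Functions on the vertices are row vectors.  The matrices of interest are
   symmetric, so that their row and column eigenspaces agree. *)
Definition averages (R : realType) (n : nat) (W : {set 'I_n}) (a : 'I_n -> R)
    (L : 'M[R]_n) : Prop :=
  forall phi : 'rV[R]_n, (phi <= L)%MS ->
    \sum_(w in W) a w * phi 0 w = n%:R^-1 * \sum_v phi 0 v.

Definition pos_extremal_design (R : realType) (n : nat) (M : 'M[R]_n)
    (s : seq R) (W : {set 'I_n}) : Prop :=
  exists a : 'I_n -> R,
    {in W, forall w, 0 < a w} /\
    (forall k : nat, (k.+1 < size s)%N -> averages W a (eigenspace M s`_k)).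

Definition minimal_pos_extremal_designs (R : realType) (n : nat) (M : 'M[R]_n)
    (s : seq R) : {set {set 'I_n}} :=
  [set W | minset (fun W' => `[< pos_extremal_design M s W' >]) W].

(* The vertices {1, ..., n} of C_n, read as Z/n, are represented by their
   residues in 'I_n, so vertex n is the ordinal 0; ordS and ord_pred are the
   cyclic successor and predecessor. *)
Definition cycle_rel (n : nat) : rel 'I_n :=
  fun i j => (j == ordS i) || (j == ord_pred i).

(* When 4 divides n, the class modulo 4 of a vertex does not depend on the
   chosen representative modulo n. *)
Definition cycle_design (n j : nat) : {set 'I_n} :=
  \bigcup_(i : 'I_n | (i == j %[mod 4])%N) [set i; ordS i].

(* Not used by the definitions: results quantifying over frequency orders are
   not vacuous, since the largest absolute value of an eigenvalue is 1. *)

Lemma roots_enum (R : realType) (p : {poly R}) : p != 0 ->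
  exists s : seq R, uniq s /\ forall x, (x \in s) = root p x.
Proof.
move: {2}(size p) (leqnn (size p)) => m; elim: m p => [|m IH] p.
  by rewrite leqn0 size_poly_eq0 => ->.
move=> sp p0; have [[r rr]|nr] := pselect (exists r, root p r); last first.
  exists [::]; split => // x; rewrite in_nil; apply/esym/negP => xr.
  by apply: nr; exists x.
have /factor_theorem[q pq] := rr.
have q0 : q != 0 by apply: contraNneq p0 => q0; rewrite pq q0 mul0r.
have [|s [us hs]] := IH q _ q0.
  by move: sp; rewrite pq size_Mmonic ?monicXsubC// size_XsubC addn2.
exists (undup (r :: s)); split; first exact: undup_uniq.
by move=> x; rewrite mem_undup inE pq rootM root_XsubC hs orbC.
Qed.

Lemma frequency_order_exists (R : realType) (n delta : nat) (e : rel 'I_n) :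
  (0 < n)%N -> (0 < delta)%N -> symmetric e ->
  (forall i, #|[pred j | e i j]| = delta) ->
  exists s : seq R, frequency_order (norm_adjacency_mx R delta e) s.
Proof.
move=> n0 d0 esym ereg; set M := norm_adjacency_mx R delta e.
have dR : (delta%:R : R) != 0 by rewrite pnatr_eq0 -lt0n.
have M0 i j : 0 <= M i j by rewrite !mxE mulr_ge0 ?invr_ge0 ?ler0n.
have Msum j : \sum_i M i j = 1.
  under eq_bigr do rewrite !mxE esym.
  rewrite -mulr_sumr -natr_sum -(big_mkcond (e j) (fun=> 1%N)).
  rewrite sum1_card (_ : #|_| = delta) ?mulVf// -(ereg j).
  exact: eq_card.
have ev1 : eigenvalue M 1.
  apply/eigenvalueP; exists (const_mx 1).
    apply/rowP => j; rewrite !mxE mulr1 -[RHS](Msum j).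
    by apply: eq_bigr => i _; rewrite !mxE mul1r.
  apply/eqP => /rowP/(_ (Ordinal n0)); rewrite !mxE => /eqP.
  by rewrite oner_eq0.
have evle x : eigenvalue M x -> `|x| <= 1.
  move=> /eigenvalueP[v vM v0].
  have [j vj] : exists j, v 0 j != 0.
    apply/existsP; apply: contraNT v0 => /existsPn v0.
    by apply/eqP/rowP => j; have := v0 j; rewrite mxE => /negPn/eqP.
  pose k := [arg max_(i > j) `|v 0 i|]%O.
  have kmax i : `|v 0 i| <= `|v 0 k|.
    by rewrite /k; case: arg_maxP => // i0 _; apply.
  have vk : 0 < `|v 0 k| by rewrite (lt_le_trans _ (kmax j))// normr_gt0.
  rewrite -(ler_pM2r vk) mul1r -normrM.
  have /rowP/(_ k) := vM; rewrite !mxE => <-.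
  rewrite (le_trans (ler_norm_sum _ _ _))//.
  rewrite -[leRHS]mulr1 -(Msum k) mulr_sumr; apply: ler_sum => i _.
  by rewrite normrM (ger0_norm (M0 _ _)) ler_wpM2r.
have [t [ut ht]] := roots_enum (monic_neq0 (char_poly_monic M)).
have t1 : 1 \in t by rewrite ht -eigenvalue_root_char.
pose r := fun x y : R => `|y| <= `|x|.
have tr : total r by move=> x y; exact: le_total.
have p1 : perm_eq (1 :: sort r (rem 1 t)) t.
  by rewrite perm_sym (perm_trans (perm_to_rem t1))// perm_cons perm_sym perm_sort.
exists (1 :: sort r (rem 1 t)); split => //.
- by rewrite (perm_uniq p1).
- by move=> x; rewrite (perm_mem p1) ht eigenvalue_root_char.
- rewrite /= path_sortedE; last by move=> x y z yx xz; exact: le_trans xz yx.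
  rewrite sort_sorted// andbT; apply/allP => x; rewrite mem_sort => /mem_rem.
  by rewrite ht -eigenvalue_root_char normr1 => /evle.
Qed.

(* Main.v *)
Require Import Defs.
From HB Require Import structures.
From mathcomp Require Import all_boot all_order all_algebra.
From mathcomp Require Import boolp reals.
From mathcomp Require Import complex zify lra.

Set Implicit Arguments.
Unset Strict Implicit.
Unset Printing Implicit Defensive.

Import Order.TTheory GRing.Theory Num.Theory.

Local Open Scope ring_scope.

(** Let M be the normalised adjacency matrix of C_n.  Since 4 divides n, 0 is an
    eigenvalue of M (take 1, 0, -1, 0, repeated), and having the smallest
    absolute value it comes last.  So weights b, extended by 0 outside W, form
    an extremal design if and only if c = b - 1/n is orthogonal to every
    eigenspace of nonzero eigenvalue.  As M is real symmetric, hence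
    diagonalizable with orthogonal eigenspaces, this says that c lies in the
    kernel of M ([symmetric_mulmx_eq0]), that is,
      b (i - 1) + b (i + 1) = 2 / n for all i.
    No eigenvector has to be computed.

    In other words b i + b (i + 2) = 2 / n with b >= 0 and support W
    ([cycle_posdesign_weights]).  Such a b exists exactly when W has period 4
    and contains i or i + 2 for every i ([cycle_posdesign_cover]): then weight
    1 / n each if both belong to W, and 2 / n if only one does.  Thus a
    design is a set of residues modulo 4 that meets both {0, 2} and {1, 3}.  The
    minimal ones pick one residue from each, which gives four sets of two
    consecutive residues; the shift by 2 exchanges such a set with its
    complement, so it has n / 2 elements. *)

(** * Real symmetric matrices *)

Lemma mulmx_tr_sym (R : comNzRingType) n (A : 'M[R]_n) (u v : 'rV[R]_n) :
  A^T = A -> u *m (v *m A)^T = (u *m A) *m v^T.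
Proof. by move=> As; rewrite trmx_mul As mulmxA. Qed.

(** The complexification of A is Hermitian, hence unitarily diagonalizable with
    real eigenvalues.  The real and imaginary parts of a complex eigenvector for
    a real eigenvalue are real eigenvectors or 0, so c is orthogonal to all rows
    of the diagonalizing matrix P except those for the eigenvalue 0; these
    are killed by the diagonal factor. *)
Lemma symmetric_mulmx_eq0 (R : rcfType) n (A : 'M[R]_n) (c : 'rV[R]_n) :
    A^T = A ->
    (forall (x : R) (v : 'rV[R]_n), x != 0 -> v *m A = x *: v -> c *m v^T = 0) ->
  c *m A = 0.
Proof.
move=> As cv; pose f : {rmorphism R -> R[i]} := real_complex R.
pose B := map_mx f A.
have Bs : B^T = B by rewrite map_trmx As.
have Bh : B \is hermsymmx.
  apply: realsym_hermsym; last first.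
    apply/mxOverP => i j; rewrite mxE.
    by apply/complex_realP; exists (A i j).
  apply/is_hermitianmxP; rewrite expr0 scale1r.
  by rewrite -[in LHS]Bs; apply/matrixP => i j; rewrite !mxE.
have /hermitian_normalmx/orthomx_spectralP BE := Bh.
have Dreal := hermitian_spectral_diag_real Bh.
move: (spectralmx B) (spectral_diag B) (spectral_unit B) BE Dreal.
move=> P D Pu BE Dreal.
have PB : P *m B = diag_mx D *m P by rewrite BE -mulmxA mulKVmx.
have cPD : map_mx f c *m P^T *m diag_mx D = 0.
  apply/rowP => i; rewrite mul_mx_diag [RHS]mxE mxE.
  have /complex_realP[x Dx] : D 0 i \is Num.real by exact: (mxOverP Dreal).
  have [x0|x0] := eqVneq x 0; first by rewrite Dx x0 mulr0.
  have Pi j : \sum_k P i k * f (A k j) = f x * P i j.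
    have /matrixP/(_ i j) := PB; rewrite mul_diag_mx !mxE Dx => <-.
    by apply: eq_bigr => k _; rewrite mxE.
  (* Used for g the real and the imaginary part, which are additive and
     commute with multiplication by real numbers. *)
  have part (g : R[i] -> R) : g 0 = 0 -> {morph g : y z / y + z} ->
      (forall y z, g (y * f z) = g y * z) ->
      \sum_j c 0 j * g (P i j) = 0.
    move=> g0 gD gZ; have := cv x (\row_j g (P i j)) x0.
    have -> : \row_j g (P i j) *m A = x *: \row_j g (P i j).
      apply/rowP => j; rewrite !mxE.
      transitivity (g (\sum_k P i k * f (A k j))).
        by rewrite (big_morph g gD g0); apply: eq_bigr => k _; rewrite gZ mxE.
      by rewrite Pi mulrC gZ mulrC.
    move=> /(_ erefl)/matrixP/(_ 0 0); rewrite !mxE => h.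
    by apply: etrans h; apply: eq_bigr => j _; rewrite !mxE.
  have re : \sum_j c 0 j * complex.Re (P i j) = 0.
    by apply: part => //; [case=> ? ? []|case=> a b z /=; rewrite mulr0 subr0].
  have im : \sum_j c 0 j * complex.Im (P i j) = 0.
    by apply: part => //; [case=> ? ? []|case=> a b z /=; rewrite mulr0 add0r].
  rewrite mxE (_ : \sum_j _ = 0) ?mul0r//.
  transitivity (f (\sum_j c 0 j * complex.Re (P i j)) +
    'i%C * f (\sum_j c 0 j * complex.Im (P i j))); last first.
    by rewrite re im !rmorph0 mulr0 addr0.
  rewrite !rmorph_sum mulr_sumr -big_split; apply: eq_bigr => j _ /=.
  by rewrite !mxE [P i j in LHS]complexE !rmorphM/= mulrDr mulrCA.
apply: (map_mx_inj (f := f)).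
rewrite map_mxM map_mx0 -/B -Bs BE.
by rewrite !trmx_mul tr_diag_mx !mulmxA cPD mul0mx.
Qed.

(** * The last eigenvalue in frequency order *)

(** Nothing can follow 0 in a duplicate-free list sorted by decreasing absolute
    value. *)
Lemma frequency_order_last0 (R : realType) n (M : 'M[R]_n) (s : seq R) k :
    frequency_order M s -> eigenvalue M 0 -> (k < size s)%N ->
  (k.+1 < size s)%N = (s`_k != 0).
Proof.
move=> [us ms _ ss] M0 ks; have s0 : 0 \in s by rewrite ms.
have i_lt : (index 0%R s < size s)%N by rewrite index_mem.
have leT_tr : transitive (fun x y : R => `|y| <= `|x|).
  by move=> x y z yx xz; exact: le_trans xz yx.
have last0 : (index 0%R s).+1 = size s.
  apply/eqP; rewrite eqn_leq i_lt leqNgt; apply/negP => lt_s.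
  have := sorted_ltn_nth leT_tr 0 ss _ _ i_lt lt_s (ltnSn _).
  rewrite nth_index// normr0 normr_le0 => /eqP s1.
  have := nth_uniq 0 lt_s i_lt us.
  by rewrite s1 nth_index// eqxx gtn_eqF.
rewrite -[X in _ != X](nth_index 0 s0) nth_uniq// -last0 ltnS ltn_neqAle.
by rewrite -ltnS last0 ks andbT.
Qed.

(** * Designs on the cycle in terms of linear equations *)

Section Cycle.
Variables (R : realType) (n : nat).
Hypothesis n_ge4 : (4 <= n)%N.
Local Notation M := (norm_adjacency_mx R 2 (@cycle_rel n)).

(** Without this the two neighbours of a vertex would coincide, and the row sums
    of the adjacency matrix would be 1 instead of 2. *)
Lemma ordS_neq_pred (i : 'I_n) : ordS i != ord_pred i.
Proof.
apply/eqP => /(congr1 val)/=; have := ltn_ord i.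
case: i => -[|i] /= _ i_n.
  by rewrite add0n !modn_small; lia.
rewrite modnDr (modn_small (ltnW i_n)).
have [i2|i2] := eqVneq i.+2 n; first by rewrite i2 modnn; lia.
by rewrite modn_small; lia.
Qed.

Lemma val_iter_ordS k (i : 'I_n) :
  (i + k < n)%N -> iter k (@ordS n) i = (i + k)%N :> nat.
Proof.
elim: k => [|k IHk] ik; first by rewrite addn0.
by rewrite iterS /= IHk ?modn_small; lia.
Qed.

Lemma cycle_mxE (v : 'rV[R]_n) i :
  (v *m M) 0 i = (v 0 (ord_pred i) + v 0 (ordS i)) / 2.
Proof.
rewrite mxE (bigD1 (ord_pred i))//= (bigD1 (ordS i)) ?ordS_neq_pred//=.
rewrite big1 ?addr0 => [|j /andP[jp jS]].
  by rewrite !mxE /cycle_rel ord_predK ordSK !eqxx orbT/=; lra.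
rewrite !mxE /cycle_rel [i == _]eq_sym [i == ord_pred j]eq_sym.
rewrite (can2_eq (@ordSK _) (@ord_predK _)) (can2_eq (@ord_predK _) (@ordSK _)).
by rewrite (negbTE jp) (negbTE jS)/= !mulr0.
Qed.

Lemma cycle_mx_sym : M^T = M.
Proof.
apply/matrixP => i j; rewrite !mxE /cycle_rel orbC.
rewrite [j == _]eq_sym [j == ord_pred _]eq_sym.
rewrite (can2_eq (@ordSK _) (@ord_predK _)).
by rewrite (can2_eq (@ord_predK _) (@ordSK _)).
Qed.

Hypothesis n4 : (n = 0 %[mod 4])%N.

Lemma ordS_mod4 (i : 'I_n) : (ordS i = i.+1 %[mod 4])%N.
Proof. by rewrite /= modn_dvdm// /dvdn n4. Qed.

(** The eigenvector is 1, 0, -1, 0, 1, 0, -1, 0, and so on; it closes up around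
    the cycle because 4 divides n. *)
Lemma cycle_eigenvalue0 : eigenvalue M 0.
Proof.
apply/eigenvalueP.
exists (\row_(i < n) ((i %% 4 == 0)%N%:R - (i %% 4 == 2)%N%:R)); last first.
  apply/eqP => /rowP/(_ (Ordinal (ltnW (ltnW (ltnW n_ge4))))).
  by rewrite !mxE /= subr0; exact/eqP/oner_neq0.
apply/rowP => j; rewrite scale0r cycle_mxE -[j]ord_predK ordSK.
move: (ord_pred j) => i; rewrite !mxE.
have h1 := ordS_mod4 i; have h2 := ordS_mod4 (ordS i).
have -> : (ordS (ordS i) %% 4 == 0)%N = (i %% 4 == 2)%N.
  by move: (ordS i) (ordS (ordS i)) h1 h2 => a b; lia.
have -> : (ordS (ordS i) %% 4 == 2)%N = (i %% 4 == 0)%N.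
  by move: (ordS i) (ordS (ordS i)) h1 h2 => a b; lia.
by lra.
Qed.

Variable s : seq R.
Hypothesis hs : frequency_order M s.

(** The vector c = b - 1/n measures the failure of averaging: its product with
    phi is the weighted sum minus the mean.  If it vanishes on the eigenvectors
    of nonzero eigenvalue then c M = 0 by [symmetric_mulmx_eq0].  Conversely, if
    c M = 0 and phi M = x phi with x != 0, then x (c . phi) = c . (phi M) =
    (c M) . phi = 0. *)
Lemma cycle_posdesign_weights (W : {set 'I_n}) :
  pos_extremal_design M s W <->
  exists b : 'I_n -> R,
    [/\ forall i, 0 <= b i, forall i, (i \in W) = (0 < b i)
      & forall i, b i + b (ordS (ordS i)) = 2 / n%:R].
Proof.
have n0 : n%:R != 0 :> R by rewrite pnatr_eq0; lia.
pose c (b : 'I_n -> R) : 'rV[R]_n := \row_i (b i - n%:R^-1).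
have cM b : c b *m M = 0 <-> forall i, b i + b (ordS (ordS i)) = 2 / n%:R.
  split=> [/rowP h i|h].
    by have := h (ordS i); rewrite cycle_mxE ordSK !mxE; lra.
  apply/rowP => i; have := h (ord_pred i); rewrite ord_predK.
  by rewrite cycle_mxE !mxE; lra.
have cdot b (phi : 'rV[R]_n) :
    (c b *m phi^T) 0 0 = \sum_i b i * phi 0 i - n%:R^-1 * \sum_i phi 0 i.
  rewrite mxE mulr_sumr -sumrB; apply: eq_bigr => i _.
  by rewrite !mxE mulrBl.
split=> [[a [a_gt0 avg]]|[b [b_ge0 bW bE]]].
  pose b i := if i \in W then a i else 0; exists b.
  split=> [i|i|]; rewrite /b.
  - by case: ifP => // /a_gt0/ltW.
  - by case: ifP => [/a_gt0->//|_]; rewrite ltxx.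
  apply/cM; apply: symmetric_mulmx_eq0 cycle_mx_sym _ => x v x0 vM.
  apply/matrixP => i j; rewrite !ord1 cdot mxE.
  apply/eqP; rewrite subr_eq0; apply/eqP.
  transitivity (\sum_(i in W) a i * v 0 i).
    rewrite [RHS]big_mkcond; apply: eq_bigr => k _; rewrite /b.
    by case: ifP => // _; rewrite mul0r.
  (* The zero vector is averaged even if x is not an eigenvalue. *)
  have [->|v0] := eqVneq v 0.
    by rewrite !big1 ?mulr0// => k _; rewrite mxE ?mulr0.
  have xs : x \in s.
    by case: hs => _ -> _ _; apply/eigenvalueP; exists v.
  have ks : (index x s < size s)%N by rewrite index_mem.
  apply: (avg (index x s)).
    by rewrite (frequency_order_last0 hs cycle_eigenvalue0)// nth_index.
  by apply/eigenspaceP; rewrite nth_index.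
exists b; split=> [i|k ks phi /eigenspaceP phiM]; first by rewrite bW.
have sk0 : s`_k != 0.
  by rewrite -(frequency_order_last0 hs cycle_eigenvalue0)// ltnW.
have -> : \sum_(w in W) b w * phi 0 w = \sum_w b w * phi 0 w.
  rewrite big_mkcond; apply: eq_bigr => i _; rewrite bW.
  by case: ltP (b_ge0 i) => // b0 b1; rewrite (@le_anti _ _ (b i) 0) ?mul0r// b0.
apply/eqP; rewrite -subr_eq0 -cdot; apply/eqP.
have /cM cbM := bE.
have : s`_k *: (c b *m phi^T) = 0.
  by rewrite scalemxAr -linearZ -phiM mulmx_tr_sym ?cycle_mx_sym// cbM mul0mx.
by move=> /matrixP/(_ 0 0)/eqP; rewrite !mxE mulf_eq0 (negbTE sk0) => /eqP.
Qed.

(** If b i + b (i + 2) is the same positive constant for all i, then the two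
    terms cannot both vanish, and b (i + 4) = b i.  In the other direction,
    the weight of i may depend only on whether i + 2 is in W: the partner of
    i + 2 is i + 4, and by period 4 it is in W exactly when i is. *)
Lemma cycle_posdesign_cover (W : {set 'I_n}) :
  pos_extremal_design M s W <->
    (forall i, (i \in W) || (ordS (ordS i) \in W)) /\
    (forall i, (ordS (ordS (ordS (ordS i))) \in W) = (i \in W)).
Proof.
have n0 : 0 < n%:R^-1 :> R by rewrite invr_gt0 ltr0n; lia.
split=> [/cycle_posdesign_weights[b [b_ge0 bW bE]]|[cov per]].
  split=> i.
    rewrite !bW; have := bE i; have := b_ge0 i; have := b_ge0 (ordS (ordS i)).
    by case: ltP => //= ?; case: ltP => //= ?; lra.
  have := bE i; have := bE (ordS (ordS i)) => b2 b0.
  by rewrite !bW (_ : b (ordS _) = b i)//; lra.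
apply/cycle_posdesign_weights.
exists (fun i => if i \in W then
  (if ordS (ordS i) \in W then n%:R^-1 else 2 / n%:R) else 0).
split=> i.
- by do 2?case: ifP => _; lra.
- by do 2?case: ifP => _; lra.
rewrite per; move: (cov i).
by case: (i \in W); case: (ordS (ordS i) \in W) => //= _; lra.
Qed.

(** * The four minimal designs *)

Lemma mem_cycle_design j (v : 'I_n) :
  (v \in cycle_design n j) = (v == j %[mod 4]) || (v == j.+1 %[mod 4]).
Proof.
apply/bigcupP/idP => [[i /eqP ij]|].
  by rewrite !inE => /orP[]/eqP->; have := ordS_mod4 i; move: (ordS i) => a; lia.
move=> /orP[vj|vj]; first by exists v => //; rewrite !inE eqxx.
exists (ord_pred v); last by rewrite !inE ord_predK eqxx orbT.
have := ordS_mod4 (ord_pred v); rewrite ord_predK.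
by move: (ord_pred v) => a; lia.
Qed.

(** The residues j and j + 1 are moved by 2 to the residues j + 2 and j + 3.
    This complementation gives the covering property, the period 4, the
    minimality and the cardinality. *)
Lemma cycle_designSS j (v : 'I_n) :
  (ordS (ordS v) \in cycle_design n j) = (v \notin cycle_design n j).
Proof.
rewrite !mem_cycle_design; have := ordS_mod4 v; have := ordS_mod4 (ordS v).
by move: (ordS v) (ordS (ordS v)) => a b; lia.
Qed.

Lemma cycle_design_posdesign j : pos_extremal_design M s (cycle_design n j).
Proof.
by apply/cycle_posdesign_cover; split=> i; rewrite !cycle_designSS ?negbK ?orbN.
Qed.

(** A vertex v of the larger set has v + 2 outside it, hence outside W, so that
    W must contain v. *)
Lemma posdesign_sub_cycle_design j (W : {set 'I_n}) :
  pos_extremal_design M s W -> W \subset cycle_design n j ->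
  W = cycle_design n j.
Proof.
move=> /cycle_posdesign_cover[cov _] /subsetP sub; apply/eqP; rewrite eqEsubset.
apply/andP; split; apply/subsetP => // v vD.
by case/orP: (cov v) => // /sub; rewrite cycle_designSS vD.
Qed.

(** Starting from the least representative u, every vertex of the class is
    reached by steps of 4 that never wrap around the cycle. *)
Lemma posdesign_mod4 (W : {set 'I_n}) (u v : 'I_n) :
  pos_extremal_design M s W -> (u < 4)%N -> v = u %[mod 4] ->
  u \in W -> v \in W.
Proof.
move=> /cycle_posdesign_cover[_ per] u4 + uW.
have [k] := ubnP v; elim: k v => // k IHk v vk vu.
have [v4|v4] := ltnP v 4.
  by rewrite (_ : v = u)//; apply: val_inj => /=; lia.
have wn : (v - 4 < n)%N by have := ltn_ord v; lia.
have -> : v = iter 4 (@ordS n) (Ordinal wn).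
  by apply: ord_inj; rewrite val_iter_ordS /=; have := ltn_ord v; lia.
by rewrite /= per; apply: IHk => /=; lia.
Qed.

(** A design contains 0 or 2, and 1 or 3; by periodicity it contains the residue
    classes of both, and two residues of different parity are consecutive modulo
    4. *)
Lemma posdesign_sup_cycle_design (W : {set 'I_n}) :
  pos_extremal_design M s W ->
  exists2 j, (1 <= j <= 4)%N & cycle_design n j \subset W.
Proof.
move=> dW; have [cov _] := iffLR (cycle_posdesign_cover W) dW.
pose u0 := Ordinal (ltnW (ltnW (ltnW n_ge4))).
have n1 : (1 < n)%N by lia.
have SE k (kn : (k < n)%N) (k1n : (k.+1 < n)%N) :
    ordS (Ordinal kn) = Ordinal k1n.
  by apply: ord_inj; rewrite /= modn_small.
have n2 : (2 < n)%N by lia.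
have n3 : (3 < n)%N by lia.
have key p q (pn : (p < n)%N) (qn : (q < n)%N) j : (p < 4)%N -> (q < 4)%N ->
    p = j %[mod 4] -> q = j.+1 %[mod 4] ->
    Ordinal pn \in W -> Ordinal qn \in W -> cycle_design n j \subset W.
  move=> p4 q4 pj qj pW qW; apply/subsetP => v.
  rewrite mem_cycle_design => /orP[]/eqP vj.
    by apply: (posdesign_mod4 dW) pW => //=; rewrite vj.
  by apply: (posdesign_mod4 dW) qW => //=; rewrite vj.
have := cov (Ordinal n1); have := cov u0.
rewrite /u0 !SE => /orP[] h0 /orP[] h1.
- by exists 4%N => //; apply: key h0 h1.
- by exists 3%N => //; apply: key h1 h0.
- by exists 1%N => //; apply: key h1 h0.
- by exists 2%N => //; apply: key h0 h1.
Qed.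

Lemma card_cycle_design j : #|cycle_design n j| = n./2.
Proof.
have f_inj : injective (fun i : 'I_n => ordS (ordS i)).
  by apply: inj_comp; apply: can_inj (@ordSK _).
have := card_preimset (cycle_design n j) f_inj.
rewrite (_ : _ @^-1: _ = ~: cycle_design n j).
  by have := cardsC (cycle_design n j); rewrite card_ord; lia.
by apply/setP => i; rewrite !inE cycle_designSS.
Qed.

Lemma cycle_design_inj j k :
  cycle_design n j = cycle_design n k -> j = k %[mod 4].
Proof.
move=> /setP E.
have H i : (i == j %[mod 4]) || (i == j.+1 %[mod 4]) ->
    (i == k %[mod 4]) || (i == k.+1 %[mod 4]).
  have := E (Ordinal (leq_trans (ltn_pmod i (isT : 0 < 4)%N) n_ge4)).
  by rewrite !mem_cycle_design /= !modn_mod => ->.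
(* j and j + 1 both lie in {k, k + 1} modulo 4, hence in this order. *)
have := H j; rewrite eqxx => /(_ isT) jk.
have := H j.+1; rewrite eqxx orbT => /(_ isT).
by lia.
Qed.

End Cycle.

Theorem theorem4p4 (R : realType) (n : nat) (hn : (4 <= n)%N)
    (hn4 : (n = 0 %[mod 4])%N) (s : seq R)
    (hs : frequency_order (norm_adjacency_mx R 2 (@cycle_rel n)) s) :
  let D :=
    minimal_pos_extremal_designs (norm_adjacency_mx R 2 (@cycle_rel n)) s in
  [/\ #|D| = 4%N,
      forall W : {set 'I_n}, W \in D -> #|W| = n./2
    & forall W : {set 'I_n}, W \in D <->
        exists2 j : nat, (1 <= j <= 4)%N & W = cycle_design n j].
Proof.
move=> D.
have DE (W : {set 'I_n}) :
    W \in D <-> exists2 j, (1 <= j <= 4)%N & W = cycle_design n j.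
  rewrite inE; split=> [/minsetP[/asboolP dW minW]|[j _ ->]].
    have [j j4 sub] := posdesign_sup_cycle_design hn hn4 hs dW.
    exists j => //; apply/esym/minW => //.
    exact/asboolP/cycle_design_posdesign.
  apply/minsetP; split=> [|B /asboolP dB sub].
    exact/asboolP/cycle_design_posdesign.
  exact: (posdesign_sub_cycle_design hn hn4 hs dB sub).
split; [|by move=> W /DE[j _ ->]; exact: card_cycle_design|exact: DE].
have -> : D = [set cycle_design n (i : 'I_4).+1 | i : 'I_4].
  apply/setP => W; apply/idP/imsetP => [/DE[[//|j] /= j4 ->]|[i _ ->]].
    by exists (Ordinal j4).
  by apply/DE; exists i.+1; rewrite // ltnS ltn_ord.
rewrite card_imset ?card_ord// => i k /(cycle_design_inj hn hn4) E.
by apply: val_inj => /=; have := ltn_ord i; have := ltn_ord k; lia.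
Qed.
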